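(* Let $(p_n)_{n\ge 0}$ be the polynomials determined by $p_0(x)=1$ and $xp_n(x)=\gamma_np_{n+1}(x)+\alpha_np_{n-1}(x)$ for $n\ge 0$, where $\alpha_0=0$, $\gamma_0=1$, and $\alpha_n>0$, $\gamma_n>0$, $\alpha_n+\gamma_n=1$ for $n\ge 1$. Put $\Delta_n(x)=p_n^2(x)-p_{n-1}(x)p_{n+1}(x)$ for $n\ge1$, and $$q_n(x)=\frac{p_{n+2}(x)-p_n(x)}{x^2-1},\quad n\ge 0,$$ with $q_{-1}:=0$. Then for all $n\ge 1$ $$\frac{\Delta_n(x)}{1-x^2}=\alpha_n\gamma_nq_{n-1}^2(x)-\alpha_{n-1}\gamma_{n+1}q_{n-2}(x)q_n(x).$$
   Context: Since $\gamma_0=1$ we have $p_n(1)=1$ and $p_n(-1)=(-1)^n$, so $p_{n+2}-p_n$ and $\Delta_n$ are divisible by $x^2-1$; hence $q_n$ and $\Delta_n(x)/(1-x^2)$ are polynomials, and the asserted identity is an identity of polynomials. (For $n=1$ the last term vanishes because $\alpha_0=0$.) *)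

(* Defs.v *)
From HB Require Import structures.
From mathcomp Require Import all_boot all_order all_algebra.
Set Implicit Arguments.
Unset Strict Implicit.
Unset Printing Implicit Defensive.
Import Order.TTheory GRing.Theory Num.Theory.
Local Open Scope ring_scope.

(* The index n.-1 stands for n - 1 and is only meaningful for n >= 1. *)
Definition Delta (R : realFieldType) (p : nat -> {poly R}) (n : nat) :
    {poly R} :=
  p n ^+ 2 - p n.-1 * p n.+1.

(* Indexed by int so that q_{-1} = 0 makes sense; only k >= -1 is relevant.
   The Euclidean quotient is exact for the sequences of interest: see
   [q_quotient_exact] below. *)
Definition q (R : realFieldType) (p : nat -> {poly R}) (k : int) : {poly R} :=
  match k with
  | Posz n => (p n.+2 - p n) %/ ('X^2 - 1)
  | Negz _ => 0
  end.

Section Exactness.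

Variables (R : realFieldType) (alpha gamma : nat -> R) (p : nat -> {poly R}).
Hypothesis halpha0 : alpha 0 = 0.
Hypothesis hgamma0 : gamma 0 = 1.
Hypothesis hgamma : forall n, (1 <= n)%N -> 0 < gamma n.
Hypothesis hsum : forall n, (1 <= n)%N -> alpha n + gamma n = 1.
Hypothesis hp0 : p 0 = 1.
Hypothesis hrec :
  forall n, 'X * p n = gamma n *: p n.+1 + alpha n *: p n.-1.

Lemma horner_p_sign (e : R) (n : nat) : e ^+ 2 = 1 -> (p n).[e] = e ^+ n.
Proof.
move=> he; suff: (p n).[e] = e ^+ n /\ (p n.+1).[e] = e ^+ n.+1 by case.
elim: n => [|n [IH0 IH1]].
  split; first by rewrite hp0 hornerE expr0.
  have := congr1 (fun f : {poly R} => f.[e]) (hrec 0).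
  by rewrite halpha0 hgamma0 hp0 mulr1 scale0r addr0 scale1r hornerX expr1.
split=> //; have := congr1 (fun f : {poly R} => f.[e]) (hrec n.+1).
rewrite hornerM hornerX hornerD !hornerZ /= IH0 IH1 => h.
have g0 : gamma n.+1 != 0 by rewrite gt_eqF ?hgamma.
have e2 : e ^+ n.+2 = e ^+ n by rewrite -addn2 exprD he mulr1.
apply: (mulfI g0); apply: (addIr (alpha n.+1 * e ^+ n)).
by rewrite -h -exprS e2 -mulrDl [gamma _ + _]addrC hsum // mul1r.
Qed.

Lemma dvdp_X2B1 (f : {poly R}) :
  f.[1] = 0 -> f.[-1] = 0 -> 'X^2 - 1 %| f.
Proof.
move=> h1 hN1.
have -> : 'X^2 - 1 = ('X - 1%:P) * ('X - (-1)%:P) :> {poly R}.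
  by rewrite polyCN opprK -subr_sqr expr1n.
rewrite Gauss_dvdp; first by rewrite !dvdp_XsubCl !rootE h1 hN1 !eqxx.
rewrite coprimep_XsubC2 // subr_eq0.
by rewrite lt_eqF // (lt_trans _ ltr01) // oppr_lt0 ltr01.
Qed.

Lemma q_quotient_exact (n : nat) :
  q p n%:Z * ('X^2 - 1) = p n.+2 - p n.
Proof.
rewrite /q divpK //; apply: dvdp_X2B1; rewrite hornerD hornerN.
  by rewrite !horner_p_sign ?expr1n ?subrr.
by rewrite !horner_p_sign ?sqrrN ?expr1n // -addn2 exprD sqrrN expr1n mulr1 subrr.
Qed.

Lemma Delta_quotient_exact (n : nat) : (1 <= n)%N ->
  (Delta p n %/ (1 - 'X^2)) * (1 - 'X^2) = Delta p n.
Proof.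
case: n => // n _; rewrite divpK // -opprB dvdpNl; apply: dvdp_X2B1.
all: rewrite /Delta !hornerE /= !horner_p_sign ?sqrrN ?expr1n //.
  by rewrite mulr1 subrr.
by rewrite -exprD -exprM mulnC mul2n -addnn addSnnS subrr.
Qed.

End Exactness.

(* Main.v *)
Require Import Defs.
From HB Require Import structures.
From mathcomp Require Import all_boot all_order all_algebra.
From mathcomp Require Import ring.
Set Implicit Arguments.
Unset Strict Implicit.
Unset Printing Implicit Defensive.
Import Order.TTheory GRing.Theory Num.Theory.
Local Open Scope ring_scope.

(* Write D = x^2 - 1. Since alpha_n + gamma_n = 1, the recurrence gives
     alpha_(n-1) D q_(n-2) = p_n - x p_(n-1),
     gamma_(n+1) D q_n = x p_(n+1) - p_n,
   while D q_(n-1) = p_(n+1) - p_(n-1). After multiplication by D^2, both sides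
   of the identity therefore involve only p_(n-1), p_n and p_(n+1), and they
   agree because x p_n = gamma_n p_(n+1) + alpha_n p_(n-1). *)

(* [a], [b], [c] stand for p_(n-1), p_n, p_(n+1), and [s], [t] for alpha_n,
   gamma_n. *)
Lemma turan_three_term (A : comPzRingType) (x s t a b c : A) :
  s + t = 1 -> x * b = t * c + s * a ->
  s * t * (c - a) ^+ 2 - (b - x * a) * (x * c - b)
    = (1 - x ^+ 2) * (b ^+ 2 - a * c).
Proof.
move=> /(canRL (addKr _)) -> hb.
(* Regrouped so that [x] multiplies [b] only inside [x * b], which [hb] eliminates; the terms in
   [x ^+ 2 * (a * c)] then cancel. *)
have -> : (1 - x ^+ 2) * (b ^+ 2 - a * c) =
    b ^+ 2 - a * c - (x * b) ^+ 2 + x ^+ 2 * (a * c) by ring.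
have -> : (b - x * a) * (x * c - b) =
    (x * b) * (a + c) - x ^+ 2 * (a * c) - b ^+ 2 by ring.
by rewrite hb; ring.
Qed.

Theorem theorem2p3 (R : realFieldType) (alpha gamma : nat -> R)
    (p : nat -> {poly R})
    (halpha0 : alpha 0%N = 0) (hgamma0 : gamma 0%N = 1)
    (halpha : forall n : nat, (1 <= n)%N -> 0 < alpha n)
    (hgamma : forall n : nat, (1 <= n)%N -> 0 < gamma n)
    (hsum : forall n : nat, (1 <= n)%N -> alpha n + gamma n = 1)
    (hp0 : p 0%N = 1)
    (* At n = 0 the last term vanishes, since alpha 0 = 0. *)
    (hrec : forall n : nat,
       'X * p n = gamma n *: p n.+1 + alpha n *: p n.-1) :
  forall n : nat, (1 <= n)%N ->
    Delta p n %/ (1 - 'X^2) =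
      (alpha n * gamma n) *: q p (n%:Z - 1) ^+ 2
      - (alpha n.-1 * gamma n.+1) *: (q p (n%:Z - 2) * q p n%:Z).
Proof.
have D_neq0 : 'X^2 - 1 != 0 :> {poly R}.
  by rewrite -size_poly_eq0 size_XnsubC.
have qE := q_quotient_exact halpha0 hgamma0 hgamma hsum hp0 hrec.
have hsumP k : (alpha k.+1)%:P + (gamma k.+1)%:P = 1 :> {poly R}.
  by rewrite -polyCD hsum.
have halphaP k : (alpha k.+1)%:P = 1 - (gamma k.+1)%:P :> {poly R}.
  by rewrite -(hsumP k) addrK.
have hrecP k : 'X * p k = (gamma k)%:P * p k.+1 + (alpha k)%:P * p k.-1.
  by rewrite hrec !mul_polyC.
case=> // n _; rewrite -!mul_polyC !polyCM -[n.+1.-1]/n.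
have -> : n.+1%:Z - 1 = n%:Z by rewrite -addn1 PoszD addrK.
have upE : (gamma n.+2)%:P * (q p n.+1%:Z * ('X^2 - 1)) = 'X * p n.+2 - p n.+1.
  by rewrite qE hrecP /= halphaP; ring.
have downE : (alpha n)%:P * (q p (n.+1%:Z - 2) * ('X^2 - 1)) = p n.+1 - 'X * p n.
  (* At [n = 0] the index of [q] is -1: [alpha 0 = 0] kills the left side, and p_1 = x p_0 the
     right. *)
  case: n {upE} => [|n].
    by rewrite halpha0 hrecP halpha0 hgamma0 !polyC0 !polyC1; ring.
  have -> : n.+2%:Z - 2 = n%:Z by rewrite -addn2 PoszD addrK.
  by rewrite qE hrecP /= halphaP; ring.
apply: (mulIf D_neq0); apply: (mulIf D_neq0).
have DeltaE := Delta_quotient_exact halpha0 hgamma0 hgamma hsum hp0 hrec (ltn0Sn n).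
have turan := turan_three_term (hsumP n) (hrecP n.+1).
(* As D^2 = (1 - x^2)^2, one factor undoes the exact division of [Delta] and the other remains. *)
transitivity ((1 - 'X^2) * Delta p n.+1).
  by rewrite -[in RHS]DeltaE; ring.
rewrite /Delta /= -turan -upE -downE -[in LHS]qE; ring.
Qed.
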